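(* Let $a\geqslant 3$ be an integer, let $\beta>1$ be a root of $X^2=aX-1$, and let $\mathcal{A}=\{0,1,\ldots,a-1\}$. Then addition in $\mathrm{Fin}_{\mathcal{A}}(\beta)$ can be performed by a digit set conversion in base $\beta$ from $\mathcal{A}+\mathcal{A}$ to $\mathcal{A}$ which is a $p$-local function with $p=11$. Moreover, $\mathcal{A}$ is the smallest alphabet for parallel addition in base $\beta$: no alphabet of contiguous integers containing $0$ and $1$ with fewer than $a$ elements allows parallel addition in base $\beta$.
   Context: For a complex number $\beta$ with $|\beta|>1$ and a finite set $\mathcal{A}\subset\mathbb{C}$ containing $0$, let $\mathrm{Fin}_{\mathcal{A}}(\beta)=\{\sum_{j\in I}x_j\beta^j : I\subset\mathbb{Z}\text{ finite},\ x_j\in\mathcal{A}\}$. For finite alphabets $\mathcal{A},\mathcal{B}$, a map $\varphi:\mathcal{A}^{\mathbb{Z}}\to\mathcal{B}^{\mathbb{Z}}$ is $p$-local if there are integers $r,t\geqslant 0$ with $p=r+t+1$ and a map $\Phi:\mathcal{A}^p\to\mathcal{B}$ such that for every $u=(u_j)$ and $v=\varphi(u)$ one has $v_j=\Phi(u_{j+t}\cdots u_j\cdots u_{j-r})$ for all $j\in\mathbb{Z}$. A digit set conversion in base $\beta$ from $\mathcal{A}$ to $\mathcal{B}$ (both containing $0$) is a map $\varphi:\mathcal{A}^{\mathbb{Z}}\to\mathcal{B}^{\mathbb{Z}}$ such that whenever $u$ has finitely many nonzero entries, $v=\varphi(u)$ has finitely many nonzero entries and $\sum_j v_j\beta^j=\sum_j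 u_j\beta^j$. An alphabet $\mathcal{A}$ allows parallel addition in base $\beta$ if there is a digit set conversion in base $\beta$ from $\mathcal{A}+\mathcal{A}=\{x+y:x,y\in\mathcal{A}\}$ to $\mathcal{A}$ that is $p$-local for some $p$. *)

(* Defs.v *)
From HB Require Import structures.
From mathcomp Require Import all_boot all_order all_algebra.
From mathcomp Require Import finmap complex.
From mathcomp Require Import mathcomp_extra boolp classical_sets functions.
From mathcomp Require Import cardinality fsbigop reals.
Set Implicit Arguments.
Unset Strict Implicit.
Unset Printing Implicit Defensive.
Import Order.TTheory GRing.Theory Num.Theory.
Local Open Scope classical_set_scope.
Local Open Scope fset_scope.
Local Open Scope ring_scope.
Local Open Scope complex_scope.

Definition finitely_supported (R : realType) (A : {fset R[i]}) (u : int -> A) :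
    Prop :=
  finite_set [set j : int | val (u j) != 0].

(* The sum is the finite-support sum over all of Z, equal to 0 by convention
   when infinitely many terms are nonzero; it is only meant for u with
   [finitely_supported u]. *)
Definition value (R : realType) (beta : R[i]) (A : {fset R[i]}) (u : int -> A) :
    R[i] :=
  \sum_(j \in [set: int]) val (u j) * beta ^ j.

Definition represents (R : realType) (beta : R[i]) (A : {fset R[i]})
    (u : int -> A) (x : R[i]) : Prop :=
  finitely_supported u /\ value beta u = x.

Definition Fin (R : realType) (beta : R[i]) (A : {fset R[i]}) : set R[i] :=
  [set z | exists (I : {fset int}) (x : int -> A),
             z = \sum_(j <- I) val (x j) * beta ^ j].

(* The window runs through u_{j+t}, ..., u_j, ..., u_{j-r} in this order. *)
Definition p_local (R : realType) (A B : {fset R[i]}) (p : nat)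
    (phi : (int -> A) -> (int -> B)) : Prop :=
  exists r t : nat, p = (r + t + 1)%N /\
  exists Phi : p.-tuple A -> B,
    forall (u : int -> A) (j : int),
      phi u j = Phi [tuple u (j + t%:Z - i%:Z) | i < p].

Definition digit_set_conversion (R : realType) (beta : R[i])
    (A B : {fset R[i]}) (phi : (int -> A) -> (int -> B)) : Prop :=
  [/\ 0 \in A, 0 \in B &
    forall u : int -> A, finitely_supported u ->
      finitely_supported (phi u) /\ value beta (phi u) = value beta u].

Definition sumset (R : realType) (A : {fset R[i]}) : {fset R[i]} :=
  [fset x + y | x in A, y in A].

Lemma sumset_mem (R : realType) (A : {fset R[i]}) (x y : A) :
  val x + val y \in sumset A.
Proof. by apply: in_imfset2; apply: valP. Qed.

Definition digitwise_add (R : realType) (A : {fset R[i]}) (u w : int -> A) :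
    int -> sumset A :=
  fun j => [` sumset_mem (u j) (w j)].

Definition performs_addition (R : realType) (beta : R[i]) (A : {fset R[i]})
    (phi : (int -> sumset A) -> (int -> A)) : Prop :=
  forall x y : R[i], Fin beta A x -> Fin beta A y ->
    Fin beta A (x + y) /\
    forall u w : int -> A, represents beta u x -> represents beta w y ->
      represents beta (phi (digitwise_add u w)) (x + y).

Definition allows_parallel_addition (R : realType) (beta : R[i])
    (A : {fset R[i]}) : Prop :=
  exists phi : (int -> sumset A) -> (int -> A),
    digit_set_conversion beta phi /\ exists p : nat, p_local p phi.

(* {m, m + 1, ..., m + n - 1} *)
Definition contiguous_alphabet (R : realType) (m : int) (n : nat) :
    {fset R[i]} :=
  [fset ((m + k%:Z)%:~R : R[i]) | k in iota 0 n].

(* Main.v *)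
(* Upper bound. Adding q_j times the digits (1, -a, 1) at positions
   j + 1, j, j - 1 does not change the value, so it suffices to choose carries
   q_j in {0, 1} that depend on few neighbouring digits. A first choice brings
   {0, ..., 2a - 2} into {0, ..., a}, looking 2 positions to each side, and a
   second one brings {0, ..., a} into {0, ..., a - 1}, looking 3 positions to
   each side; 2 * (2 + 3) + 1 = 11.

   Lower bound. Let B = {m, ..., M} allow parallel addition, and let y be the
   digit that the conversion writes inside a long block of digits M. Comparing
   blocks of lengths N and N + 1 gives an integer polynomial that vanishes at
   beta, hence is divisible by X^2 - a X + 1, as beta is irrational. Evaluating
   it at 1 gives y = M modulo a - 2. If y = M, then a block of M ended by 2M
   has too large a value for its output, as beta > 2. If y = m, evaluating the
   polynomial at the conjugate 1/beta of beta yields a contradiction of signs.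
   So M - y is a positive multiple of a - 2 and y > m, whence M - m >= a - 1. *)

Require Import Defs.
From mathcomp Require Import all_boot all_order all_algebra.
From mathcomp Require Import finmap complex.
From mathcomp Require Import mathcomp_extra boolp classical_sets functions.
From mathcomp Require Import cardinality fsbigop reals.
From mathcomp Require Import zify ring lra.
Set Implicit Arguments.
Unset Strict Implicit.
Unset Printing Implicit Defensive.
Import Order.TTheory GRing.Theory Num.Theory.
Local Open Scope fset_scope.
Local Open Scope ring_scope.
Local Open Scope complex_scope.

(** * Finitely supported integer sequences *)

Lemma fsumT_nat (V : nmodType) (n : nat) (F : int -> V) :
  (forall j : int, ~ (0 <= j < n%:Z) -> F j = 0) ->
  \sum_(j \in [set: int]) F j = \sum_(0 <= i < n) F i%:Z.
Proof.
move=> F0; rewrite (fsbigE [seq i%:Z | i <- iota 0 n]) //.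
- under eq_bigl do rewrite in_setT.
  by rewrite big_map /index_iota subn0.
- by rewrite map_inj_uniq ?iota_uniq // => i j [].
- move=> j _ jn; apply: F0 => /andP[j0 jlt]; move/negP: jn; apply.
  by apply/mapP; exists `|j|%N; [rewrite mem_iota; lia | lia].
Qed.

Definition fin_supp (x : int -> int) : Prop := finite_set [set j | x j != 0].

Lemma fin_suppP (x : int -> int) :
  fin_supp x -> exists X : {fset int}, forall j, j \notin X -> x j = 0.
Proof.
move=> /finite_fsetP[X xX]; exists X => j jX; apply/eqP.
by apply: contraNT jX => xj; have : [set` X]%classic j by rewrite -xX.
Qed.

Lemma fin_supp_sub (x y : int -> int) :
  (forall j, y j = 0 -> x j = 0) -> fin_supp y -> fin_supp x.
Proof. by move=> yx; apply: sub_finite_set => j; apply: contra_neq => /yx. Qed.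

Lemma fin_suppD (x y : int -> int) :
  fin_supp x -> fin_supp y -> fin_supp (fun j => x j + y j).
Proof.
move=> /fin_suppP[X xX] /fin_suppP[Y yY].
apply: (@finite_subfset _ (X `|` Y)) => j /=; apply: contra_neqT.
by rewrite inE negb_or => /andP[jX jY]; rewrite xX // yY.
Qed.

Lemma fin_supp_shift (k : int) (x : int -> int) :
  fin_supp x -> fin_supp (fun j => x (j + k)).
Proof.
move=> /(finite_image (fun j => j - k)); apply: sub_finite_set => j xj.
by exists (j + k) => //; rewrite addrK.
Qed.

Lemma fin_suppZ (c : int) (x : int -> int) :
  fin_supp x -> fin_supp (fun j => c * x j).
Proof. by apply: fin_supp_sub => j ->; rewrite mulr0. Qed.

(** * Values of digit sequences and their invariance under carries *)

Section Evaluation.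

Variables (F : fieldType) (beta : F).
Hypothesis beta_neq0 : beta != 0.

Definition eval_digits (x : int -> int) : F :=
  \sum_(j \in [set: int]) (x j)%:~R * beta ^ j.

Lemma eval_digits_fset (X : {fset int}) (x : int -> int) :
  (forall j, j \notin X -> x j = 0) ->
  eval_digits x = \sum_(j <- X) (x j)%:~R * beta ^ j.
Proof. by move=> xX; apply: fsbigTE => j /xX->; rewrite mul0r. Qed.

Lemma eval_digitsD (x y : int -> int) : fin_supp x -> fin_supp y ->
  eval_digits (fun j => x j + y j) = eval_digits x + eval_digits y.
Proof.
move=> /fin_suppP[X xX] /fin_suppP[Y yY].
have xXY j : j \notin X `|` Y -> x j = 0.
  by rewrite inE negb_or => /andP[/xX].
have yXY j : j \notin X `|` Y -> y j = 0.
  by rewrite inE negb_or => /andP[_ /yY].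
rewrite (eval_digits_fset xXY) (eval_digits_fset yXY) -big_split /=.
rewrite (@eval_digits_fset (X `|` Y)) => [|j jXY]; last by rewrite xXY ?yXY.
by apply: eq_bigr => j _; rewrite rmorphD mulrDl.
Qed.

Lemma eval_digitsZ (c : int) (x : int -> int) : fin_supp x ->
  eval_digits (fun j => c * x j) = c%:~R * eval_digits x.
Proof.
move=> /fin_suppP[X xX]; rewrite (eval_digits_fset xX) mulr_sumr.
rewrite (@eval_digits_fset X) => [|j /xX->]; last by rewrite mulr0.
by apply: eq_bigr => j _; rewrite rmorphM mulrA.
Qed.

Lemma eval_digits_shift (k : int) (x : int -> int) : fin_supp x ->
  eval_digits (fun j => x (j + k)) = beta ^ (- k) * eval_digits x.
Proof.
move=> /fin_suppP[X xX]; rewrite (eval_digits_fset xX) mulr_sumr.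
rewrite /eval_digits (reindex_fsbigT (fun j => j - k)); last first.
  by exists (fun j => j + k) => j; rewrite ?addrK ?subrK.
rewrite (fsbigTE X) => [|j jX]; last by rewrite subrK xX // mul0r.
by apply: eq_bigr => j _; rewrite subrK exprzDr ?unitfE // mulrA mulrC.
Qed.

(** Position [j] pays [a * q j] and receives the carries of both neighbours. *)
Definition carry_convert (a : nat) (q x : int -> int) (j : int) : int :=
  x j + (- a%:Z * q j + (q (j - 1) + q (j + 1))).

Lemma fin_supp_carry_convert (a : nat) (q x : int -> int) :
  fin_supp x -> fin_supp q -> fin_supp (carry_convert a q x).
Proof.
move=> xfin qfin; apply: fin_suppD => //; apply: fin_suppD.
  exact: fin_suppZ.
by apply: fin_suppD; apply: fin_supp_shift.
Qed.

(** The value changes by [- a + beta + beta^-1] times the value of [q], and this factor is zero by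
    the equation of [beta]. *)
Lemma eval_carry_convert (a : nat) (q x : int -> int) :
  beta ^+ 2 = a%:R * beta - 1 -> fin_supp x -> fin_supp q ->
  eval_digits (carry_convert a q x) = eval_digits x.
Proof.
move=> hb xfin qfin.
have qZ := fin_suppZ (- a%:Z) qfin.
have qm := fin_supp_shift (-1) qfin.
have qp := fin_supp_shift 1 qfin.
have qmp := fin_suppD qm qp.
rewrite eval_digitsD //; last exact: fin_suppD.
rewrite eval_digitsD // eval_digitsD // eval_digitsZ // !eval_digits_shift //.
rewrite opprK expr1z exprN1 -!mulrDl rmorphN /= -[a%:~R]/(a%:R : F).
suff -> : - a%:R + (beta + beta^-1) = 0 by rewrite mul0r addr0.
apply: (mulfI beta_neq0); rewrite mulr0 !mulrDr mulfV // -expr2 hb; ring.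
Qed.

End Evaluation.

(** * Locality of maps on integer sequences *)

(** Allowing two different positions [i] and [j] builds commutation with shifts into the notion,
    besides dependence on a window of radius [r]. *)
Definition window_determined (r : nat) (f : (int -> int) -> int -> int) : Prop :=
  forall (x y : int -> int) (i j : int),
    (forall k : int, `|k| <= r%:Z -> x (i + k) = y (j + k)) -> f x i = f y j.

Lemma window_determined_comp (r s : nat) (f g : (int -> int) -> int -> int) :
  window_determined r f -> window_determined s g ->
  window_determined (r + s) (f \o g).
Proof.
move=> fr gs x y i j xy; apply: fr => k kr; apply: gs => l ls.
by rewrite -!addrA; apply: xy; lia.
Qed.

(** The radius grows by one because position [j] uses the carries at [j - 1] and [j + 1]. *)
Lemma window_determined_carry_convert (a r : nat) (q : (int -> int) -> int -> int) :
  window_determined r q ->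
  window_determined r.+1 (fun x => carry_convert a (q x) x).
Proof.
move=> qr x y i j xy; rewrite /carry_convert.
have qk k : `|k| <= 1 -> q x (i + k) = q y (j + k).
  by move=> k1; apply: qr => l lr; rewrite -!addrA; apply: xy; lia.
have := xy 0; rewrite !addr0 => -> //.
have := qk 0; rewrite !addr0 => -> //.
by rewrite !qk.
Qed.

(** * The two carry rules *)

Section Carries.

Variable a : nat.
Hypothesis a_ge3 : (3 <= a)%N.

(** Without the second clause, a digit [a - 1] between two digits at least [a] would become
    [a + 1]. *)
Definition first_carry (x : int -> int) (j : int) : int :=
  ((a%:Z <= x j) ||
   [&& x j == a%:Z - 1, a%:Z <= x (j - 1) & a%:Z <= x (j + 1)] : bool).

Definition first_step (x : int -> int) : int -> int :=
  carry_convert a (first_carry x) x.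

(** A neighbour at least [a - 1] of a digit [a - 1] is itself forced to carry, so the [-1] left by
    the carry is always compensated. *)
Definition forced_carry (x : int -> int) (j : int) : bool :=
  (a%:Z <= x j) ||
  (x j == a%:Z - 1) && ((a%:Z - 1 <= x (j - 1)) || (a%:Z - 1 <= x (j + 1))).

(** Without the second clause, a digit [a - 2] between two forced carries would become [a]. *)
Definition second_carry (x : int -> int) (j : int) : int :=
  (forced_carry x j ||
   [&& x j == a%:Z - 2, forced_carry x (j - 1) & forced_carry x (j + 1)] : bool).

Definition second_step (x : int -> int) : int -> int :=
  carry_convert a (second_carry x) x.

Lemma window_determined_first_carry : window_determined 1 first_carry.
Proof.
move=> x y i j xy; rewrite /first_carry !xy //.
by have := xy 0; rewrite !addr0 => ->.
Qed.

Lemma window_determined_second_carry : window_determined 2 second_carry.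
Proof.
have fr x y i j : (forall k : int, `|k| <= 1%:Z -> x (i + k) = y (j + k)) ->
    forced_carry x i = forced_carry y j.
  move=> xy; rewrite /forced_carry !xy //.
  by have := xy 0; rewrite !addr0 => ->.
move=> x y i j xy; rewrite /second_carry.
have fk k : `|k| <= 1 -> forced_carry x (i + k) = forced_carry y (j + k).
  by move=> k1; apply: fr => l l1; rewrite -!addrA; apply: xy; lia.
have := xy 0; rewrite !addr0 => -> //.
have := fk 0; rewrite !addr0 => -> //.
by rewrite !fk.
Qed.

(** A digit at least [a] drops to at most [a - 2] and then receives at most 2. A carrying [a - 1]
    receives exactly 2; any other [a - 1] receives at most 1, since a neighbour of it carries only
    if it is at least [a]. Smaller digits do not carry and receive at most 2. *)
Lemma first_step_bounds (x : int -> int) (j : int) :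
  (forall i, 0 <= x i <= a%:Z * 2 - 2) -> 0 <= first_step x j <= a%:Z.
Proof.
move=> x_bnd; rewrite /first_step /carry_convert /first_carry.
rewrite !subrK !addrK.
have [] := (x_bnd (j - 1 - 1), x_bnd (j - 1)).
have [] := (x_bnd (j + 1 + 1), x_bnd (j + 1)).
have := x_bnd j.
lia.
Qed.

(** A digit [a] becomes at most [2 <= a - 1]. A carrying [a - 1] receives at least 1, any other
    [a - 1] receives nothing. A carrying [a - 2] receives 2, any other receives at most 1, because
    next to [a - 2] only forced positions carry. *)
Lemma second_step_bounds (x : int -> int) (j : int) :
  (forall i, 0 <= x i <= a%:Z) -> 0 <= second_step x j <= a%:Z - 1.
Proof.
move=> x_bnd; rewrite /second_step /carry_convert /second_carry /forced_carry.
rewrite !subrK !addrK.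
have [] := (x_bnd (j - 1 - 1), x_bnd (j - 1)).
have [] := (x_bnd (j + 1 + 1), x_bnd (j + 1)).
have := x_bnd j.
lia.
Qed.

Lemma fin_supp_first_carry (x : int -> int) : fin_supp x -> fin_supp (first_carry x).
Proof. by apply: fin_supp_sub => j xj; rewrite /first_carry xj; lia. Qed.

(** The digit 0 never carries, because [a - 2] is positive. *)
Lemma fin_supp_second_carry (x : int -> int) : fin_supp x -> fin_supp (second_carry x).
Proof.
by apply: fin_supp_sub => j xj; rewrite /second_carry /forced_carry xj; lia.
Qed.

End Carries.

(** * Integer digits of complex alphabets *)

(** A total inverse of the embedding of the integers into [R[i]]; it is meant for integer arguments
    only. *)
Definition digit (R : realType) (z : R[i]) : int := Num.floor (complex.Re z).

Lemma digit_intr (R : realType) (k : int) : digit (k%:~R : R[i]) = k.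
Proof. by rewrite /digit -(rmorph_int (real_complex R)) /= intrKfloor. Qed.

Lemma contiguous_alphabetP (R : realType) (m : int) (n : nat) (z : R[i]) :
  reflect (exists2 k : int, m <= k < m + n%:Z & z = k%:~R)
    (z \in contiguous_alphabet R m n).
Proof.
apply: (iffP (imfsetP _ _ _ _)) => [[k kn ->]|[k kmn ->]].
  by exists (m + k%:Z) => //; move: kn; rewrite /= mem_iota; lia.
exists `|k - m|%N; first by rewrite /= mem_iota; lia.
by congr (_%:~R); lia.
Qed.

Lemma digit_contiguous (R : realType) (m : int) (n : nat)
    (z : contiguous_alphabet R m n) :
  val z = (digit (val z))%:~R /\ m <= digit (val z) < m + n%:Z.
Proof.
by have /contiguous_alphabetP[k kmn ->] := valP z; rewrite digit_intr.
Qed.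

Lemma digit_sumset_contiguous (R : realType) (m : int) (n : nat)
    (z : sumset (contiguous_alphabet R m n)) :
  val z = (digit (val z))%:~R /\
  m * 2 <= digit (val z) <= (m + n%:Z - 1) * 2.
Proof.
have /imfset2P[_ /contiguous_alphabetP[k kmn ->]
  [_ /contiguous_alphabetP[l lmn ->] ->]] := valP z.
by rewrite -rmorphD digit_intr; split=> //; lia.
Qed.

Section IntegerAlphabet.

Variables (R : realType) (A : {fset R[i]}).
Hypothesis A_int : forall z : A, val z = (digit (val z))%:~R.

Definition digits (u : int -> A) : int -> int := fun j => digit (val (u j)).

Lemma fin_supp_digits (u : int -> A) :
  finitely_supported u <-> fin_supp (digits u).
Proof.
rewrite /finitely_supported /fin_supp /digits; set S := [set j | _]%classic.
suff -> : S = [set j | digit (val (u j)) != 0]%classic by [].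
by apply: eq_set => j; rewrite [in LHS]A_int intr_eq0.
Qed.

Lemma value_digits (beta : R[i]) (u : int -> A) :
  value beta u = eval_digits beta (digits u).
Proof. by apply: eq_fsbigr => j _; rewrite [in LHS]A_int. Qed.

End IntegerAlphabet.

(** * Digitwise addition and the set [Fin] *)

Lemma valueD (R : realType) (beta : R[i]) (A : {fset R[i]}) (u w : int -> A) :
  finitely_supported u -> finitely_supported w ->
  finitely_supported (digitwise_add u w) /\
  value beta (digitwise_add u w) = value beta u + value beta w.
Proof.
move=> /finite_fsetP[X uX] /finite_fsetP[Y wY].
have uXY j : j \notin X `|` Y -> val (u j) = 0.
  rewrite inE negb_or => /andP[jX _]; apply/eqP; apply: contraNT jX => uj.
  by have : [set` X]%classic j by rewrite -uX.
have wXY j : j \notin X `|` Y -> val (w j) = 0.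
  rewrite inE negb_or => /andP[_ jY]; apply/eqP; apply: contraNT jY => wj.
  by have : [set` Y]%classic j by rewrite -wY.
split.
  apply: (@finite_subfset _ (X `|` Y)) => j /=; apply: contra_neqT => jXY.
  by rewrite uXY // wXY // addr0.
rewrite /value !(fsbigTE (X `|` Y)) => [|j jXY|j jXY|j jXY].
- by rewrite -big_split; apply: eq_bigr => j _; rewrite /= mulrDl.
- by rewrite wXY // mul0r.
- by rewrite uXY // mul0r.
- by rewrite /= uXY // wXY // addr0 mul0r.
Qed.

(** A sum over [I] does not constrain the digits outside [I]; replacing these by 0 gives a finitely
    supported sequence with the same value. *)
Lemma Fin_represents (R : realType) (beta : R[i]) (A : {fset R[i]}) (x : R[i]) :
  0 \in A -> Fin beta A x <-> exists u : int -> A, represents beta u x.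
Proof.
move=> A0; split=> [[I [u ->]]|[u [/finite_fsetP[X uX] <-]]].
  pose v j := if j \in I then u j else [` A0].
  have vI j : j \notin I -> val (v j) = 0 by rewrite /v => /negbTE->.
  exists v; split; last first.
    rewrite /value (fsbigTE I) => [|j /vI->]; last by rewrite mul0r.
    by apply: eq_big_seq => j jI; rewrite /v jI.
  by apply: (@finite_subfset _ I) => j /=; apply: contra_neqT => /vI.
exists X, u; apply: fsbigTE => j jX.
suff -> : val (u j) = 0 by rewrite mul0r.
apply/eqP; apply: contraNT jX => uj.
by have : [set` X]%classic j by rewrite -uX.
Qed.

(** The conversion acts on the digitwise sum, which already has value [x + y]; its output shows that
    [Fin] is closed under addition. *)
Lemma digit_set_conversion_performs_addition (R : realType) (beta : R[i])
    (A : {fset R[i]}) (phi : (int -> sumset A) -> (int -> A)) :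
  digit_set_conversion beta phi -> performs_addition beta phi.
Proof.
case=> _ A0 phi_conv x y.
have add u w : represents beta u x -> represents beta w y ->
    represents beta (phi (digitwise_add u w)) (x + y).
  move=> [ufin <-] [wfin <-].
  have [uwfin <-] := valueD beta ufin wfin.
  by have [] := phi_conv _ uwfin.
move=> /Fin_represents-/(_ A0)[u xu] /Fin_represents-/(_ A0)[w yw].
by split=> //; apply/Fin_represents => //; exists (phi (digitwise_add u w)); apply: add.
Qed.

(** * The 11-local addition algorithm *)

Section ParallelAddition.

Variables (R : realType) (a : nat) (beta : R[i]).
Hypothesis a_ge3 : (3 <= a)%N.
Hypothesis hbeta : beta ^+ 2 = a%:R * beta - 1.

Local Notation A := (contiguous_alphabet R 0 a).

Lemma alphabet0 : 0 \in A.
Proof. by apply/contiguous_alphabetP; exists 0 => //; lia. Qed.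

(** Integers out of range are sent to 0; [second_step_bounds] excludes this case for the sums
    treated here. *)
Definition to_alphabet (k : int) : A := insubd [` alphabet0] (k%:~R : R[i]).

Lemma digit_to_alphabet (k : int) : 0 <= k < a%:Z -> digit (val (to_alphabet k)) = k.
Proof.
move=> ka; rewrite val_insubd ifT ?digit_intr //.
by apply/contiguous_alphabetP; exists k => //; rewrite add0r.
Qed.

Definition add_step (x : int -> int) : int -> int := second_step a (first_step a x).

Lemma window_determined_add_step : window_determined 5 add_step.
Proof.
(* Each step has the radius of its carry rule plus one: 2 + 1 for the second and 1 + 1 for the
   first. *)
apply: (@window_determined_comp 3 2).
  exact/window_determined_carry_convert/window_determined_second_carry.
exact/window_determined_carry_convert/window_determined_first_carry.
Qed.

Definition parallel_add (u : int -> sumset A) : int -> A :=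
  fun j => to_alphabet (add_step (digits u) j).

Lemma p_local_parallel_add : p_local 11 parallel_add.
Proof.
exists 5%N, 5%N; split=> //.
(* The window lists positions [j + 5] down to [j - 5], so offset [k] is entry [5 - k]. Only
   [|k| <= 5] matters, and there the absolute value changes nothing. *)
exists (fun w => to_alphabet
  (add_step (fun k => digit (val (tnth w (inord `|5 - k|%N)))) 0)).
move=> u j; congr to_alphabet; apply: window_determined_add_step => k k5.
by rewrite /digits tnth_mktuple inordK; [congr (digit (val (u _))) |]; lia.
Qed.

Lemma parallel_add_conversion : digit_set_conversion beta parallel_add.
Proof.
have b0 : beta != 0.
  by apply: contra_eq_neq hbeta => ->; rewrite expr0n mulr0 sub0r eq_sym oppr_eq0 oner_neq0.
have A0 := alphabet0; split=> // [|u].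
  by apply/imfset2P; exists 0 => //; exists 0 => //; rewrite addr0.
have Sint (z : sumset A) := (digit_sumset_contiguous z).1.
have Aint (z : A) := (digit_contiguous z).1.
rewrite (fin_supp_digits Sint) (fin_supp_digits Aint) !value_digits // => ufin.
have u_bnd i : 0 <= digits u i <= a%:Z * 2 - 2.
  by have [_] := digit_sumset_contiguous (u i); rewrite /digits; lia.
have -> : digits (parallel_add u) = add_step (digits u).
  apply/funext => j; apply: digit_to_alphabet.
  have := second_step_bounds a_ge3 j (fun i => first_step_bounds a_ge3 i u_bnd).
  by rewrite /add_step; lia.
have c1 := fin_supp_first_carry a_ge3 ufin.
have f1 := fin_supp_carry_convert a ufin c1.
have c2 := fin_supp_second_carry a_ge3 f1.
split; first exact: fin_supp_carry_convert.
by rewrite /add_step /second_step !eval_carry_convert.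
Qed.

End ParallelAddition.

(** * Arithmetic of the quadratic base *)

Section QuadraticBase.

Variables (R : realFieldType) (a : nat) (beta : R).
Hypotheses (a_ge3 : (3 <= a)%N) (beta_gt1 : 1 < beta).
Hypothesis hbeta : beta ^+ 2 = a%:R * beta - 1.

(** Both bounds come from signs of products: [(beta - 1) * (beta - (a - 1)) = a - 2] and
    [beta * (a - beta) = 1]. In particular [beta > 2]. *)
Lemma quadratic_base_bounds : a%:R - 1 < beta < a%:R.
Proof.
have a3 : (3 : R) <= a%:R by rewrite ler_nat.
have b1 : 0 < beta - 1 by rewrite subr_gt0.
have b0 : 0 < beta by rewrite (lt_trans ltr01).
apply/andP; split; rewrite -subr_gt0.
  rewrite -(pmulr_rgt0 _ b1).
  suff -> : (beta - 1) * (beta - (a%:R - 1)) = a%:R - 2 by lra.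
  by rewrite mulrBl mulrBr -expr2 hbeta; ring.
rewrite -(pmulr_rgt0 _ b0).
suff -> : beta * (a%:R - beta) = 1 by lra.
by rewrite mulrBr -expr2 hbeta; ring.
Qed.

(* Descent on the denominator: if d beta is an integer, then so is
   beta * d (a - beta) = d, and 0 < d (a - beta) < d. *)
Lemma quadratic_base_irrational (d : nat) (e : int) :
  d%:R * beta = e%:~R -> d = 0%N.
Proof.
elim/ltn_ind: d e => d IH e de; apply/eqP; apply: contraT; rewrite -lt0n => d0.
have /andP[lb ub] := quadratic_base_bounds.
have dR : (0 : R) < d%:R by rewrite ltr0n.
have qE : (a%:Z * d%:Z - e)%:~R = d%:R * (a%:R - beta) :> R.
  by rewrite rmorphB rmorphM /= -de -!pmulrn; ring.
have q0 : 0 < a%:Z * d%:Z - e.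
  by rewrite -(ltr0z R) qE mulr_gt0 // subr_gt0.
have qd : a%:Z * d%:Z - e < d%:Z.
  rewrite -(ltr_int R) qE -[X in _ < X]mulr1 ltr_pM2l //; lra.
case q : (a%:Z * d%:Z - e) => [k|k]; last by lia.
have kE : k%:R = d%:R * (a%:R - beta) :> R by rewrite -qE q.
suff : k = 0%N by lia.
apply: (IH k _ d%:Z); first by lia.
rewrite kE -mulrA mulrBl -expr2 hbeta -pmulrn; ring.
Qed.

(** Division by a monic polynomial stays over the integers; the remainder has degree at most 1 and
    vanishes at the irrational [beta], so it is zero. *)
Lemma quadratic_base_minpoly (D : {poly int}) :
  root (map_poly intr D : {poly R}) beta ->
  exists Q : {poly int}, D = Q * ('X^2 - a%:Z%:P * 'X + 1).
Proof.
set f := _ + 1; move=> Dbeta.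
have sg : (size (1 - a%:Z%:P * 'X : {poly int})%R <= 2)%N.
  apply: leq_trans (size_polyD _ _) _; rewrite size_poly1 geq_max /= size_polyN.
  by apply: leq_trans (size_polyMleq _ _) _; rewrite size_polyX size_polyC; case: eqP.
have fE : f = 'X^2 + (1 - a%:Z%:P * 'X) by rewrite /f; ring.
have sf : size f = 3%N by rewrite fE size_polyDl size_polyXn.
have fmon : f \is monic.
  by rewrite fE monicE lead_coefDl ?size_polyXn ?lead_coefXn.
have := Pdiv.RingMonic.rdivp_eq fmon D.
set Q := Pdiv.Ring.rdivp _ _; set r := Pdiv.Ring.rmodp _ _ => DE.
have sr : (size r < 3)%N by rewrite -sf Pdiv.Ring.ltn_rmodp monic_neq0.
exists Q; rewrite {1}DE -[RHS]addr0; congr (_ + _).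
have fb : (map_poly intr f : {poly R}).[beta] = 0.
  rewrite /f !(rmorphD, rmorphN, rmorphM, rmorph1, rmorphXn) /=.
  rewrite map_polyX map_polyC !hornerE /= -expr2 hbeta -pmulrn; ring.
have rb : (map_poly intr r : {poly R}).[beta] = 0.
  move: Dbeta; rewrite DE rmorphD rmorphM /= rootE hornerD hornerM fb mulr0 add0r.
  by move/eqP.
have rE : (r`_0)%:~R + (r`_1)%:~R * beta = 0 :> R.
  rewrite -[RHS]rb (horner_coef_wide (n := 2)); last first.
    by rewrite (leq_trans (size_poly _ _)).
  by rewrite big_ord_recl big_ord1 !coef_map /= expr0 mulr1 expr1.
have r1 : r`_1 = 0.
  apply/eqP; rewrite -absz_eq0; apply/eqP.
  (* The irrationality lemma takes a natural multiple of [beta], hence the split on the sign of the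
     leading coefficient. *)
  case E : (r`_1) rE => [k|k] rE.
    apply: (@quadratic_base_irrational _ (- r`_0)).
    by rewrite rmorphN /= pmulrn; lra.
  apply: (@quadratic_base_irrational _ (r`_0)).
  by move: rE; rewrite NegzE rmorphN /= -pmulrn mulNr; lra.
have r0 : r`_0 = 0.
  by apply/eqP; rewrite -(intr_eq0 R) -rE r1 mul0r addr0.
by apply/polyP => -[|[|i]]; rewrite coef0 // nth_default // (leq_trans _ (_ : 2 <= i.+2)%N).
Qed.

(** The quadratic factor of [D] takes the value [2 - a] at 1. *)
Lemma quadratic_base_dvd (D : {poly int}) :
  root (map_poly intr D : {poly R}) beta -> (a%:Z - 2 %| D.[1])%Z.
Proof.
move=> /quadratic_base_minpoly[Q ->]; apply/dvdzP; exists (- Q.[1]).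
by rewrite !hornerE /= expr1n; ring.
Qed.

(** The quadratic factor of [D] is reciprocal, so [beta^-1] is its other root. *)
Lemma quadratic_base_conjugate (D : {poly int}) :
  root (map_poly intr D : {poly R}) beta ->
  root (map_poly intr D : {poly R}) beta^-1.
Proof.
move=> /quadratic_base_minpoly[Q ->].
rewrite !(rmorphD, rmorphN, rmorphM, rmorph1, rmorphXn) /= rootE.
rewrite map_polyX map_polyC !hornerE /= -pmulrn.
have b0 : beta != 0 by rewrite gt_eqF // (lt_trans ltr01).
suff -> : beta^-1 ^+ 2 - a%:R / beta + 1 = 0 by rewrite mulr0.
apply: (mulfI (expf_neq0 2 b0)); rewrite mulr0 !mulrDr mulrN.
have -> : beta ^+ 2 * beta^-1 ^+ 2 = 1 by rewrite -exprMn mulfV // expr1n.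
have -> : beta ^+ 2 * (a%:R / beta) = a%:R * beta by field.
by rewrite mulr1 hbeta; ring.
Qed.

Lemma geometric_sum (x : R) (p q : nat) : (p <= q)%N ->
  (x - 1) * (\sum_(p <= i < q) x ^+ i) = x ^+ q - x ^+ p.
Proof.
move=> pq; rewrite mulr_sumr -(telescope_sumr (fun i => x ^+ i)) //.
by apply: eq_bigr => i _; rewrite exprS; ring.
Qed.

Lemma digit_sum_bounds (m M : int) (v : nat -> int) (x : R) (p q : nat) :
  0 <= x -> (forall i, m <= v i <= M) ->
  m%:~R * (\sum_(p <= i < q) x ^+ i) <= \sum_(p <= i < q) (v i)%:~R * x ^+ i
    <= M%:~R * (\sum_(p <= i < q) x ^+ i).
Proof.
move=> x0 vmM; rewrite !mulr_sumr !ler_sum // => i _;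
  by rewrite ler_wpM2r ?exprn_ge0 // ler_int; case/andP: (vmM i).
Qed.

(* The digits v represent 2M at position t followed by a block of N digits M;
   y is the digit that a local conversion inserts into v when this block is
   lengthened by one, whence the first equation. *)
Lemma contiguous_digits_gap (m M y : int) (v : nat -> int) (t N n : nat) :
  m <= 0 -> 0 < M -> m <= y <= M -> (forall i, m <= v i <= M) -> (N < n)%N ->
  M%:~R * beta ^+ (t + N.+1) =
    y%:~R * beta ^+ N.+1
    + (beta - 1) * (\sum_(N.+1 <= i < n) (v i)%:~R * beta ^+ i) ->
  (beta - 1) * (\sum_(0 <= i < n) (v i)%:~R * beta ^+ i) =
    M%:~R * (2 * beta ^+ t * (beta - 1) + (beta ^+ (t + N.+1) - beta ^+ t.+1)) ->
  a%:Z - 1 <= M - m.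
Proof.
move=> m0 M0 /andP[my yM] vmM Nn gap total.
have /andP[beta_lb _] := quadratic_base_bounds.
have a3 : (3 : R) <= a%:R by rewrite ler_nat.
have b_gt1 := beta_gt1.
have MR : (0 : R) < M%:~R by rewrite ltr0z.
(* If [y = M], then [gap] fixes the contribution of the digits above [N], and the lower ones add at
   most [M * (beta ^+ N.+1 - 1)]. Comparison with [total] gives [beta ^+ t * (beta - 2) + 1 <= 0],
   against [beta > 2]. *)
have ynM : y != M.
  apply: contraTneq isT => yE; move: gap; rewrite yE.
  set hi := (beta - 1) * _ => gap.
  move: total; rewrite (big_cat_nat (leq0n N.+1) Nn) /= mulrDr -/hi => total.
  have lo : (beta - 1) * (\sum_(0 <= i < N.+1) (v i)%:~R * beta ^+ i) <=
      M%:~R * (beta ^+ N.+1 - 1).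
    rewrite -[1 in X in _ <= X](expr0 beta) -geometric_sum // mulrCA.
    rewrite ler_wpM2l ?subr_ge0 //; first by lra.
    by have /andP[] := @digit_sum_bounds m M v beta 0 N.+1 ltac:(lra) vmM.
  have : M%:~R * (2 * beta ^+ t * (beta - 1) - beta ^+ t.+1 + 1) <= 0.
    have -> : M%:~R * (2 * beta ^+ t * (beta - 1) - beta ^+ t.+1 + 1) =
        M%:~R * (2 * beta ^+ t * (beta - 1) + (beta ^+ (t + N.+1) - beta ^+ t.+1))
        - M%:~R * beta ^+ (t + N.+1) + M%:~R.
      by ring.
    by rewrite -total gap; lra.
  have bt : 0 < beta ^+ t by rewrite exprn_gt0; lra.
  rewrite pmulr_rle0 // exprS => h; exfalso.
  by have := mulr_ge0 (ltW bt) (_ : 0 <= beta - 2); nra.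
(* The equation [gap] with [beta] replaced by an indeterminate; at 1 the sum drops out and [M - y]
   remains. *)
pose D : {poly int} := M%:P * 'X^(t + N.+1) - y%:P * 'X^(N.+1)
  - ('X - 1) * (\sum_(N.+1 <= i < n) (v i)%:P * 'X^i).
have DE x : (map_poly intr D : {poly R}).[x] =
    M%:~R * x ^+ (t + N.+1) - y%:~R * x ^+ N.+1
    - (x - 1) * (\sum_(N.+1 <= i < n) (v i)%:~R * x ^+ i).
  rewrite /D !(rmorphB, rmorphM, rmorph_sum, rmorphXn, rmorph1) /=.
  rewrite map_polyX !map_polyC !hornerE /= horner_sum; congr (_ - _ * _).
  by apply: eq_bigr => i _; rewrite rmorphM rmorphXn /= map_polyX map_polyC !hornerE.
have Dbeta : root (map_poly intr D : {poly R}) beta.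
  by rewrite rootE DE gap; apply/eqP; ring.
have Ddvd : (a%:Z - 2 %| M - y)%Z.
  have := quadratic_base_dvd Dbeta.
  by rewrite /D !hornerE /= !expr1n !mulr1.
(* At [x = beta^-1] the factor [x - 1] is negative, so bounding the digits below by [m = y] gives
   [D(x) >= M * x ^+ (t + N.+1) - m * x ^+ n > 0], although [x] is a root. *)
have ynm : y != m.
  apply: contraTneq isT => yE.
  have := quadratic_base_conjugate Dbeta; rewrite rootE DE yE => /eqP.
  set x := beta^-1.
  have x0 : 0 < x by rewrite invr_gt0; lra.
  have x1 : x < 1 by rewrite invf_lt1; lra.
  have /andP[hi _] := @digit_sum_bounds m M v x N.+1 n (ltW x0) vmM.
  have := geometric_sum x Nn.
  have : 0 < M%:~R * x ^+ (t + N.+1) by rewrite mulr_gt0 ?exprn_gt0.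
  have : m%:~R * x ^+ n <= 0 by rewrite mulr_le0_ge0 ?exprn_ge0 ?lerz0 // ltW.
  move: hi; set S := \sum_(_ <= _ < _) _; set T := \sum_(_ <= _ < _) _.
  move=> ST mx Mx geo eq0; exfalso.
  have : (x - 1) * T <= (x - 1) * (m%:~R * S).
    by rewrite ler_wnM2l // subr_le0 ltW.
  by rewrite mulrCA geo; lra.
have a2 : 0 < M - y by rewrite subr_gt0 lt_neqAle ynM.
have a20 : 0 < a%:Z - 2 by lia.
have : a%:Z - 2 <= M - y.
  have /dvdzP[k kE] := Ddvd; move: a2; rewrite kE pmulr_lgt0 // => k0.
  by rewrite ler_peMl // ltW.
by move: ynm my; lia.
Qed.

End QuadraticBase.

(** * Lower bound on the size of the alphabet *)

Section LowerBound.

Variables (R : realType) (a : nat) (beta : R).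
Hypotheses (a_ge3 : (3 <= a)%N) (beta_gt1 : 1 < beta).
Hypothesis hbeta : beta ^+ 2 = a%:R * beta - 1.

Lemma eval_digits_nat (n : nat) (x : int -> int) :
  (forall j : int, ~ (0 <= j < n%:Z) -> x j = 0) ->
  eval_digits beta%:C x = (\sum_(0 <= i < n) (x i%:Z)%:~R * beta ^+ i)%:C.
Proof.
move=> x0; rewrite /eval_digits (fsumT_nat (n := n)) => [|j /x0->]; last first.
  by rewrite mul0r.
rewrite rmorph_sum; apply: eq_bigr => i _.
by rewrite rmorphM rmorphXn /= rmorph_int.
Qed.

Lemma parallel_addition_card (m : int) (n : nat) :
  0 \in contiguous_alphabet R m n -> 1 \in contiguous_alphabet R m n ->
  allows_parallel_addition beta%:C (contiguous_alphabet R m n) -> (a <= n)%N.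
Proof.
set B := contiguous_alphabet R m n => B0 B1.
have intr_eq (k l : int) : k%:~R = l%:~R :> R[i] -> k = l.
  by move=> /(congr1 (@digit R)); rewrite !digit_intr.
have m0 : m <= 0.
  have /contiguous_alphabetP[k kmn] := B0.
  by move=> /(intr_eq 0) k0; lia.
have M0 : 0 < m + n%:Z - 1.
  have /contiguous_alphabetP[k kmn] := B1.
  by move=> /(intr_eq 1) k0; lia.
case=> phi [[_ _ phi_conv] [p [r [t [pE [Phi PhiE]]]]]].
set M := m + n%:Z - 1 in M0.
have BM : M%:~R \in B by apply/contiguous_alphabetP; exists M => //; lia.
(* The input digits 0, [M] and [2M], as elements of the sumset. *)
pose e0 : sumset B := [` sumset_mem [` B0] [` B0]].
pose e1 : sumset B := [` sumset_mem [` BM] [` B0]].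
pose e2 : sumset B := [` sumset_mem [` BM] [` BM]].
have e0E : digit (val e0) = 0 by rewrite /= addr0 (digit_intr R 0).
have e1E : digit (val e1) = M by rewrite /= addr0 digit_intr.
have e2E : digit (val e2) = M + M by rewrite /= -rmorphD digit_intr.
have Sint (z : sumset B) := (digit_sumset_contiguous z).1.
have Bint (z : B) := (digit_contiguous z).1.
have B_bnd (z : B) : m <= digit (val z) <= M.
  by have [_] := digit_contiguous z; rewrite /M; move: (digit _) => d; lia.
have local (u w : int -> sumset B) (j l : int) :
    (forall i : int, - r%:Z <= i <= t%:Z -> u (j + i) = w (l + i)) ->
    digits (phi u) j = digits (phi w) l.
  move=> uw; rewrite /digits !PhiE.
  suff -> : [tuple u (j + t%:Z - i%:Z) | i < p] = [tuple w (l + t%:Z - i%:Z) | i < p].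
    by [].
  apply: eq_from_tnth => i.
  rewrite !tnth_mktuple -!addrA uw //; have := ltn_ord i; lia.
(* By locality the image of the zero sequence is constant; being finitely supported, it vanishes
   somewhere, hence everywhere. *)
have zeroE : digits (phi (fun=> e0)) 0 = 0.
  have fin0 : finitely_supported (fun _ : int => e0).
    apply/(fin_supp_digits Sint)/(@finite_subfset _ fset0) => j.
    by rewrite /digits /mkset e0E eqxx.
  have [/(fin_supp_digits Bint)/fin_suppP[X phiX] _] := phi_conv _ fin0.
  have [j jX] : exists j : int, j \notin X.
    have Xs : uniq [seq i%:Z | i <- iota 0 (size X).+1].
      by rewrite map_inj_uniq ?iota_uniq // => k l [].
    have : has (fun j => j \notin X) [seq i%:Z | i <- iota 0 (size X).+1].
      apply: contraT; rewrite has_predC negbK => /allP /(uniq_leq_size Xs).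
      by rewrite size_map size_iota ltnn.
    by case/hasP => j _ jX; exists j.
  by rewrite -(phiX j jX); exact: local.
(* Output position [j] sees inputs [j - r] to [j + t]; starting the input at [t] keeps the output on
   nonnegative positions. *)
pose u (N : nat) (j : int) : sumset B :=
  if j == t%:Z then e2 else if t%:Z < j <= t%:Z + N%:Z then e1 else e0.
pose y := digits (phi (fun=> e1)) 0.
(* With this [N], the window of output position [N + 1] is exactly the block of [N + 1] digits [M]
   in [u N.+1]. *)
pose N := (r + t)%N.
pose v k := digits (phi (u k)).
have v_bnd k j : m <= v k j <= M.
  exact: B_bnd.
have v_supp k j : ~ (0 <= j < (t + k + 1 + r)%:Z) -> v k j = 0.
  move=> jk; rewrite -zeroE; apply: local => i ir.
  by rewrite /u !ifF //; lia.
have u_supp k j : ~ (0 <= j < (t + k + 1)%:Z) -> digits (u k) j = 0.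
  by move=> jk; rewrite /digits /u !ifF //; lia.
have uv k : \sum_(0 <= i < t + k + 1 + r) (v k i%:Z)%:~R * beta ^+ i =
    \sum_(0 <= i < t + k + 1) (digits (u k) i%:Z)%:~R * beta ^+ i.
  have fin : finitely_supported (u k).
    apply/(fin_supp_digits Sint)/(@finite_subfset _ [fset i%:Z | i in iota 0 (t + k + 1)]).
    move=> j /=; apply: contra_neqT => jk; apply: u_supp => jtk.
    move/negP: jk; apply; apply/imfsetP; exists `|j|%N; last by lia.
    by rewrite /= mem_iota; lia.
  have [_] := phi_conv _ fin; rewrite !value_digits // -/(v k).
  by rewrite (eval_digits_nat (v_supp k)) (eval_digits_nat (u_supp k)) => -[].
have u_sum k : \sum_(0 <= i < t + k + 1) (digits (u k) i%:Z)%:~R * beta ^+ i =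
    (M + M)%:~R * beta ^+ t + M%:~R * (\sum_(t.+1 <= i < t + k + 1) beta ^+ i).
  rewrite (big_cat_nat (leq0n t)) /=; last by lia.
  rewrite big_nat big1 => [|i it]; last first.
    by rewrite /digits /u !ifF ?e0E ?mul0r //; lia.
  rewrite add0r big_ltn ?mulr_sumr; last by lia.
  rewrite /digits /u eqxx e2E; congr (_ + _); rewrite big_nat [RHS]big_nat.
  apply: eq_bigr => i itk; rewrite ifF ?ifT ?e1E //; lia.
have v_low i : (i < N.+1)%N -> v N.+1 i%:Z = v N i%:Z.
  move=> iN; apply: local => l lr.
  by rewrite /u; do ![case: ifP => ?] => //; lia.
have v_mid : v N.+1 N.+1%:Z = y.
  apply: local => l lr.
  by rewrite /u; do ![case: ifP => ?] => //; lia.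
have v_high i : (N.+1 <= i)%N -> v N.+1 i.+1%:Z = v N i%:Z.
  move=> iN; apply: local => l lr.
  by rewrite /u; do ![case: ifP => ?] => //; lia.
(* Lengthening the block by one keeps the output up to position [N], inserts [y] at [N + 1] and
   shifts the rest up by one. *)
have v_longer : \sum_(0 <= i < t + N.+1 + 1 + r) (v N.+1 i%:Z)%:~R * beta ^+ i =
    \sum_(0 <= i < N.+1) (v N i%:Z)%:~R * beta ^+ i + (y%:~R * beta ^+ N.+1 +
    beta * (\sum_(N.+1 <= i < t + N + 1 + r) (v N i%:Z)%:~R * beta ^+ i)).
  rewrite (big_cat_nat (leq0n N.+1)) /=; last by lia.
  congr (_ + _); first by apply: eq_big_nat => i iN; rewrite v_low.
  rewrite big_ltn ?v_mid; last by lia.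
  congr (_ + _); rewrite (_ : (t + N.+1 + 1 + r = (t + N + 1 + r).+1)%N); last by lia.
  rewrite big_add1 mulr_sumr; apply: eq_big_nat => i /andP[iN _].
  by rewrite v_high // exprS mulrCA.
suff : a%:Z - 1 <= M - m by lia.
apply: (@contiguous_digits_gap R a beta a_ge3 beta_gt1 hbeta m M y
  (fun i => v N i%:Z) t N (t + N + 1 + r)) => //.
- exact: B_bnd.
- by lia.
(* The difference of the two value identities: the inputs differ by [M * beta ^+ (t + N.+1)]. *)
- have := uv N.+1; have := uv N; rewrite !u_sum v_longer.
  rewrite (big_cat_nat (leq0n N.+1)) /=; last by lia.
  rewrite (_ : (t + N.+1 + 1 = (t + N + 1).+1)%N); last by lia.
  rewrite (_ : (t + N.+1 = t + N + 1)%N); last by lia.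
  rewrite [\sum_(t.+1 <= _ < _.+1) _]big_nat_recr /=; last by lia.
  by lra.
- rewrite uv u_sum mulrDr mulrCA [X in _ + X]mulrCA.
  rewrite geometric_sum; last by lia.
  rewrite rmorphD /= (_ : (t + N.+1 = t + N + 1)%N); last by lia.
  by ring.
Qed.

End LowerBound.

(** * Cardinality of the alphabet and conclusion *)

(** Distinct integers stay distinct in [R[i]]; this turns a lower bound on [n] into one on the
    cardinality. *)
Lemma card_contiguous_alphabet (R : realType) (m : int) (n : nat) :
  (n <= #|` contiguous_alphabet R m n|)%N.
Proof.
pose s := [seq (m + k%:Z)%:~R : R[i] | k <- iota 0 n].
have us : uniq s.
  rewrite map_inj_uniq ?iota_uniq // => k l /(congr1 (@digit R)).
  by rewrite !digit_intr; lia.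
have : {subset s <= contiguous_alphabet R m n}.
  move=> _ /mapP[k kn ->]; apply/contiguous_alphabetP; exists (m + k%:Z) => //.
  by move: kn; rewrite mem_iota; lia.
by move=> /(uniq_leq_size us); rewrite size_map size_iota.
Qed.

Theorem theorem33 (R : realType) (a : nat) (beta : R)
    (ha : (3 <= a)%N) (hbeta1 : 1 < beta)
    (hbeta : beta ^+ 2 = a%:R * beta - 1) :
  let A := contiguous_alphabet R 0 a in
  (exists phi : (int -> sumset A) -> (int -> A),
     [/\ digit_set_conversion beta%:C phi, p_local 11 phi &
         performs_addition beta%:C phi]) /\
  (forall (m : int) (n : nat),
     let B := contiguous_alphabet R m n in
     0 \in B -> 1 \in B -> (#|` B| < a)%N ->
     ~ allows_parallel_addition beta%:C B).
Proof.
split.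
  have hbetaC : beta%:C ^+ 2 = a%:R * beta%:C - 1.
    by rewrite -rmorphXn hbeta rmorphB rmorphM rmorph1 rmorph_nat.
  have conv := parallel_add_conversion ha hbetaC.
  exists (parallel_add ha); split=> //; first exact: p_local_parallel_add.
  exact: digit_set_conversion_performs_addition.
move=> m n B B0 B1 Ba Badd.
have an := parallel_addition_card ha hbeta1 hbeta B0 B1 Badd.
by have := leq_trans an (card_contiguous_alphabet R m n); rewrite leqNgt Ba.
Qed.
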